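(* Let $n\ge1$ and $\kappa>0$. For each $1\le i\le n$, the statistic $h^{\mathrm{B}}_i\colon\mathcal{A}^{\mathrm{B}}_\kappa(\mathsf{A}^n)\to\mathbb{R}_{>0}$ is multiplicatively $\kappa$-mesic with respect to the action of $\mathrm{LK}^{\mathrm{B}}=\mathrm{rvac}^{\mathrm{B}}_{\mathcal{A}}$ on $\mathcal{A}^{\mathrm{B}}_\kappa(\mathsf{A}^n)$; that is, for every finite orbit $O$, $\big(\prod_{\pi\in O}h^{\mathrm{B}}_i(\pi)\big)^{1/\#O}=\kappa$.
   Context: $\mathsf{A}^n$ is the poset of intervals $[i,j]=\{i,\dots,j\}$, $1\le i\le j\le n$, ordered by inclusion, graded of rank $r=n-1$ with $\mathrm{rk}([i,j])=j-i$; $\mathsf{A}^n_k$ = rank-$k$ elements. $\mathcal{A}^{\mathrm{B}}_\kappa(\mathsf{A}^n)=\mathbb{R}_{>0}^{\mathsf{A}^n}$. Birational antichain toggle $\tau_p$: changes only the value at $p$, to $\kappa/\sum_C\prod_{y\in C}\pi(y)$, sum over maximal chains $C$ of $\mathsf{A}^n$ containing $p$. $\boldsymbol{\tau}_k=\prod_{p\in\mathsf{A}^n_k}\tau_p$; products are compositions, rightmost first. $\mathrm{LK}^{\mathrm{B}}=\mathrm{rvac}^{\mathrm{B}}_{\mathcal{A}}=(\boldsymbol{\tau}_r)(\boldsymbol{\tau}_r\boldsymbol{\tau}_{r-1})\cdots(\boldsymbol{\tau}_r\cdots\boldsymbol{\tau}_1)(\boldsymbol{\tau}_r\cdots\boldsymbol{\tau}_1\boldsymbol{\tau}_0)$.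 $h^{\mathrm{B}}_i(\pi)=\prod_{i\le j\le n}\pi([i,j])\cdot\prod_{1\le j\le i}\pi([j,i])$. *)

(* Defs.v *)
From HB Require Import structures.
From mathcomp Require Import all_boot all_order all_algebra.
From mathcomp Require Import finmap.
From mathcomp Require Import all_classical all_reals all_analysis.

Set Implicit Arguments.
Unset Strict Implicit.
Unset Printing Implicit Defensive.

Import Order.TTheory GRing.Theory Num.Theory.
Local Open Scope ring_scope.

Section Chains.
Context (d : Order.disp_t) (P : finPOrderType d).

Definition chain (C : {set P}) : bool :=
  [forall x in C, forall y in C, (x >=< y)%O].

Definition maxchain (C : {set P}) : bool := maxset chain C.

Lemma maxchain_mem (p : P) : exists2 C, maxchain C & p \in C.
Proof.
have [C maxC /fintype.subsetP sub] : {C | maxchain C & [set p] \subset C}.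
  apply: maxset_exists; apply/forall_inP => x /set1P ->.
  by apply/forall_inP => y /set1P ->; exact: Order.POrderTheory.comparablexx.
by exists C => //; apply: sub; rewrite set11.
Qed.

End Chains.

Section Rowvacuation.
Context (R : realType) (d : Order.disp_t) (P : finPOrderType d).

Definition labeling : Type := {ffun P -> {posnum R}}.

HB.instance Definition _ := Choice.on labeling.

Definition chain_sum (p : P) (pi : labeling) : R :=
  \sum_(C : {set P} | maxchain C && (p \in C)) \prod_(y in C) (pi y)%:num.

Lemma chain_sum_gt0 (p : P) (pi : labeling) : 0 < chain_sum p pi.
Proof.
have [C maxC pC] := maxchain_mem p.
rewrite /chain_sum (bigD1 C) /=; last by rewrite maxC.
apply: ltr_pwDl; first by apply: prodr_gt0 => y _.
by apply: sumr_ge0 => D _; apply: prodr_ge0 => y _.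
Qed.

Lemma toggle_value_gt0 (kappa : {posnum R}) (p : P) (pi : labeling) :
  0 < kappa%:num / chain_sum p pi.
Proof. by rewrite divr_gt0 ?chain_sum_gt0. Qed.

Definition toggle (kappa : {posnum R}) (p : P) (pi : labeling) : labeling :=
  [ffun x => if x == p then PosNum (toggle_value_gt0 kappa p pi) else pi x].

(* In each [\big] of maps below, the leftmost factor is the outermost one:
   [f_0 \o (f_1 \o ... )], so that the rightmost factor is applied first. *)

Definition rank_toggle (rk : P -> nat) (kappa : {posnum R}) (k : nat) :
    labeling -> labeling :=
  \big[(fun f g => f \o g)/id]_(p : P | rk p == k) toggle kappa p.

(* The factor of index [j] is [tau_r tau_(r-1) ... tau_(r-j)]. *)
Definition rvac (r : nat) (rk : P -> nat) (kappa : {posnum R}) :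
    labeling -> labeling :=
  \big[(fun f g => f \o g)/id]_(j < r.+1)
    \big[(fun f g => f \o g)/id]_(l < j.+1) rank_toggle rk kappa (r - l)%N.

End Rowvacuation.

Section Homomesy.
Context (R : realType) (T : choiceType).

(* The orbits of an invertible map [f] under the action of the group generated
   by [f]; the second disjunct accounts for the negative powers of [f]. *)
Definition is_orbit (f : T -> T) (O : set T) : Prop :=
  exists x, O = [set y | exists m, iter m f x = y \/ iter m f y = x]%classic.

Definition mult_mesic (f : T -> T) (h : T -> R) (c : R) : Prop :=
  forall O : set T, is_orbit f O -> finite_set O ->
    (\prod_(x <- fset_set O) h x) `^ (#|` fset_set O|%:R^-1) = c.

End Homomesy.

(* Endpoints are 0-based: [[i, j]] with [1 <= i <= j <= n] has endpoints
   [i - 1] and [j - 1] in ['I_n]. *)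
Record segment (n : nat) := Segment {
  ends : 'I_n * 'I_n;
  ends_le : (ends.1 <= ends.2)%N
}.

HB.instance Definition _ n := [isSub for @ends n].
HB.instance Definition _ n := [Finite of segment n by <:].

Section SegmentPoset.
Context (n : nat).
Implicit Types p q : segment n.

Definition elements p : {set 'I_n} :=
  [set k : 'I_n | ((ends p).1 <= k <= (ends p).2)%N].

Definition segment_le p q : bool := elements p \subset elements q.

Fact segment_le_refl : reflexive segment_le.
Proof. by move=> p; exact: fintype.subxx. Qed.

Fact segment_le_anti : antisymmetric segment_le.
Proof.
move=> [[a b] /= ab] [[a' b'] /= ab'] /andP[].
rewrite /segment_le => /fintype.subsetP pq /fintype.subsetP qp.
have := pq a; have := pq b; have := qp a'; have := qp b'.
rewrite !inE /= !leqnn ab ab' /= => /(_ isT)/andP[_ h1] /(_ isT)/andP[h2 _].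
move=> /(_ isT)/andP[_ h3] /(_ isT)/andP[h4 _].
apply: val_inj => /=; congr pair; apply: val_inj; apply/eqP.
  by rewrite eqn_leq h2 h4.
by rewrite eqn_leq h1 h3.
Qed.

Fact segment_le_trans : transitive segment_le.
Proof. by move=> q p s; exact: fintype.subset_trans. Qed.

HB.instance Definition _ := Order.Le_isPOrder.Build Order.default_display
  (segment n) segment_le_refl segment_le_anti segment_le_trans.

Definition segment_rank p : nat := ((ends p).2 - (ends p).1)%N.

(* [[i, j]] when [i <= j]; the value [[i, i]] otherwise is never used. *)
Definition seg (i j : 'I_n) : segment n :=
  insubd (Segment (leqnn i : ((i, i).1 <= (i, i).2)%N)) (i, j).

End SegmentPoset.

Section LalanneKreweras.
Context (R : realType) (n : nat).

Definition LK (kappa : {posnum R}) :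
    labeling R (segment n) -> labeling R (segment n) :=
  rvac n.-1 (@segment_rank n) kappa.

Definition hstat (i : 'I_n) (pi : labeling R (segment n)) : R :=
  (\prod_(j < n | (i <= j)%N) (pi (seg i j))%:num) *
  (\prod_(j < n | (j <= i)%N) (pi (seg j i))%:num).

End LalanneKreweras.

(* Main.v *)
(* Write X_i = prod_{j >= i} pi[i,j] and Y_i = prod_{j <= i} pi[j,i], so that
   h_i = X_i * Y_i. The point is the refined identity
     X_i(pi) * Y_i(LK pi) = kappa,
   together with its mirror image under [i,j] -> [n+1-j,n+1-i]; multiplying the
   two gives h_i(pi) * h_i(LK pi) = kappa^2 pointwise, and LK, being injective,
   permutes each finite orbit.
   Let Dn(p), resp. Up(p), be the sum over the maximal chains of the elements
   below, resp. above, p, so that the sum over the maximal chains through p is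
   Dn(p) * Up(p) / pi(p). If pi_m is obtained from pi after m of the factors
   tau_r ... tau_k of LK (k = 0, 1, ..., m-1), then
     Dn(pi_{m+1})(p) * Up(pi_m)(p) = kappa        for rk p >= m,
   and pi_{m+1} = pi_m in ranks < m. Since Dn and Up satisfy two-term recursions
   over the covers of an interval, the identity follows from an induction along
   the column of i, in which each step is a telescoping product. *)
Require Import Defs.
From mathcomp Require Import all_boot all_order all_algebra.
From mathcomp Require Import finmap.
From mathcomp Require Import all_classical all_reals all_analysis.
From mathcomp Require Import ring zify.

Set Implicit Arguments.
Unset Strict Implicit.
Unset Printing Implicit Defensive.

Import Order.TTheory GRing.Theory Num.Theory.
Local Open Scope ring_scope.

(** * Maximal chains below a fixed element and their weighted sums *)

(* The relation r is kept abstract in order to be instantiated with both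
   orders <= and >=. *)
Section DownChains.
Context (R : realType) (T : finType) (r : rel T).
Hypotheses (rxx : reflexive r) (r_anti : antisymmetric r) (r_trans : transitive r).
Implicit Types (p q x y : T) (C : {set T}) (v : T -> R).

Definition rcomp x y := r x y || r y x.

(** The maximal chains of the principal ideal of [p], or of its filter when [r] is the reversed
    order. Maximality is tested one element at a time. *)
Definition down_chain p C : bool :=
  [&& p \in C, [forall x in C, r x p],
    [forall x in C, forall y in C, rcomp x y] &
    [forall x, r x p && [forall y in C, rcomp x y] ==> (x \in C)]].

Definition down_sum v p : R := \sum_(C | down_chain p C) \prod_(y in C) v y.

Definition covered q p : bool :=
  [&& q != p, r q p & [forall x, r q x && r x p ==> (x == q) || (x == p)]].

Lemma down_chainP p C :
  reflect [/\ p \in C, {in C, forall x, r x p}, {in C &, forall x y, rcomp x y} &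
    forall x, r x p -> {in C, forall y, rcomp x y} -> x \in C]
    (down_chain p C).
Proof.
apply: (iffP and4P) => [[pC /forall_inP Cp]|[pC Cp]].
  move=> /forall_inP Cc /forallP Cm; split=> //.
  - by move=> x y /Cc /forall_inP; apply.
  - move=> x xp xC; move: (Cm x); rewrite xp /= => /implyP; apply.
    exact/forall_inP.
move=> Cc Cm; split=> //; first exact/forall_inP.
- by apply/forall_inP => x xC; apply/forall_inP => y yC; exact: Cc.
- apply/forallP => x; apply/implyP => /andP[xp /forall_inP xC]; exact: Cm.
Qed.

Lemma rcompC x y : rcomp x y = rcomp y x. Proof. by rewrite /rcomp orbC. Qed.

Lemma rcompxx x : rcomp x x. Proof. by rewrite /rcomp rxx. Qed.

Lemma coveredP q p :
  reflect [/\ q != p, r q p & forall x, r q x -> r x p -> x = q \/ x = p]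
    (covered q p).
Proof.
apply: (iffP and3P) => -[qp rqp].
  move=> /forallP h; split=> // x qx xp; move: (h x); rewrite qx xp /=.
  by case/orP => /eqP; [left|right].
move=> h; split=> //; apply/forallP => x; apply/implyP => /andP[qx xp].
by case: (h x qx xp) => ->; rewrite eqxx ?orbT.
Qed.

Lemma eq_down_sum v v' p :
  (forall y, r y p -> v y = v' y) -> down_sum v p = down_sum v' p.
Proof.
move=> vv'; apply: eq_bigr => C /down_chainP[_ Cp _ _].
by apply: eq_bigr => y /Cp /vv'.
Qed.

Lemma down_chain_min p C : (forall x, r x p -> x = p) ->
  down_chain p C = (C == [set p]).
Proof.
move=> minp; apply/down_chainP/eqP => [[pC Cp _ _]|->].
  apply/setP => x; rewrite finset.in_set1; apply/idP/eqP => [/Cp /minp //|-> //].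
split; rewrite ?finset.in_set1 //.
- by move=> x /set1P ->.
- by move=> x y /set1P -> /set1P ->; exact: rcompxx.
- by move=> x /minp ->; rewrite finset.in_set1.
Qed.

Lemma down_sum_min v p : (forall x, r x p -> x = p) -> down_sum v p = v p.
Proof.
move=> minp; rewrite /down_sum (eq_bigl (pred1 [set p])) /=.
  by rewrite big_pred1_eq big_set1.
by move=> C; rewrite (down_chain_min _ minp).
Qed.

(** By maximality a non-minimal [p] is not alone in [C]. The largest remaining element is covered by
    [p], since anything in between could be added to [C], and no smaller element of [C] is. *)
Lemma covered_mem_down_chain p C : (exists2 x, x != p & r x p) ->
  down_chain p C -> exists q, (fun q => covered q p && (q \in C)) =1 pred1 q.
Proof.
move=> [z zp rzp] /down_chainP[pC Cp Cc Cm].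
have [w wCp] : exists w, w \in C :\ p.
  apply/finset.set0Pn/negP => /eqP C0.
  have Cpe x : x \in C -> x = p.
    move=> xC; apply/eqP/negPn/negP => xp.
    by have := finset.in_setD1 x C p; rewrite C0 finset.in_set0 xp xC.
  suff /Cpe ze : z \in C by rewrite ze eqxx in zp.
  by apply: Cm => // y /Cpe ->; rewrite /rcomp rzp.
(* In a finite chain, the element with the most elements below it is the largest. *)
pose f x := #|[set y | r y x]|.
have [q /setD1P[qp qC] qmax] := @arg_maxnP _ w (mem (C :\ p)) f wCp.
have le_q y : y \in C -> y != p -> r y q.
  move=> yC yp; case/orP: (Cc _ _ yC qC) => // rqy.
  have := qmax y; rewrite !inE yp yC => /(_ isT) fyq.
  have sub : [set x | r x q] \subset [set x | r x y].
    by apply/fintype.subsetP => x; rewrite !inE => /r_trans; apply.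
  have /eqP e : [set x | r x q] == [set x | r x y] by rewrite eqEcard sub.
  by have := finset.in_set (fun x => r x q) y; rewrite e finset.in_set rxx => <-.
have qcov : covered q p.
  apply/coveredP; split=> //; first exact: Cp.
  move=> x qx xp; have [->|xp'] := eqVneq x p; [by right|left].
  apply: r_anti; rewrite qx andbT; apply: (le_q x) => //; apply: Cm => // y yC.
  have [->|yp] := eqVneq y p; first by rewrite /rcomp xp.
  by rewrite /rcomp (r_trans (le_q _ yC yp) qx) orbT.
exists q => x /=; apply/andP/eqP => [[/coveredP[xp rxp xm] xC]|-> //].
by case: (xm q (le_q _ xC xp) (Cp _ qC)) => // qpe; rewrite qpe eqxx in qp.
Qed.

(** Sort the chains by their unique element covered by [p]; deleting [p] leaves the maximal chains
    below that element. *)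
Lemma down_sum_covered v p : (exists2 x, x != p & r x p) ->
  down_sum v p = v p * \sum_(q | covered q p) down_sum v q.
Proof.
move=> np; rewrite /down_sum mulr_sumr.
transitivity (\sum_(C | down_chain p C)
   \sum_(q | covered q p && (q \in C)) \prod_(y in C) v y).
  apply: eq_bigr => C /(covered_mem_down_chain np)[q qC].
  by rewrite (eq_bigl _ _ qC) big_pred1_eq.
rewrite (exchange_big_dep (fun q => covered q p)) /=; last by move=> ? ? _ /andP[].
apply: eq_bigr => q cqp; have /coveredP[qp rqp qmax] := cqp.
rewrite cqp mulr_sumr /=.
rewrite (reindex_onto (fun D : {set T} => p |: D) (fun C => C :\ p)) /=; last first.
  by move=> C /andP[/down_chainP[pC _ _ _] _]; exact: finset.setD1K.
have pD D : down_chain q D -> p \notin D.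
  move=> /down_chainP[_ Dq _ _]; apply/negP => /Dq rpq.
  by move/eqP: qp; apply; apply: r_anti; rewrite rqp rpq.
apply: eq_big => D; last first.
  move=> /andP[_ /eqP De]; have pnD : p \notin D by rewrite -De setD11.
  by rewrite big_setU1.
have [pinD|pnD] := boolP (p \in D).
  rewrite (negbTE (contraL (@pD D) pinD)); apply/negP => /andP[_ /eqP De].
  by move: pinD; rewrite -De setD11.
rewrite finset.setU1K // eqxx andbT; apply/andP/down_chainP.
  case=> /down_chainP[_ Dp Dc Dm] /setU1P[qpe|qD]; first by rewrite qpe eqxx in qp.
  have le_q x : x \in D -> r x q.
    move=> xD; have xD' : x \in p |: D by rewrite setU1r.
    case/orP: (Dc x q xD' (setU1r _ qD)) => // rqx.
    by case: (qmax x rqx (Dp _ xD')) => xe; rewrite xe ?rxx // -xe xD in pnD *.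
  split=> //.
  - by move=> x y xD yD; apply: Dc; rewrite setU1r.
  - move=> x rxq xD; have rxp := r_trans rxq rqp.
    have /setU1P[xe|//] : x \in p |: D.
      apply: Dm => // y /setU1P[->|/xD //]; by rewrite /rcomp rxp.
    by case/eqP: qp; apply: r_anti; rewrite rqp -xe.
case=> qD Dq Dc Dm; rewrite setU1r //; split=> //; apply/down_chainP; split.
- by rewrite setU11.
- by move=> x /setU1P[-> //|/Dq /r_trans]; apply.
- have Dp x : x \in D -> rcomp x p by move=> /Dq /r_trans/(_ rqp); rewrite /rcomp => ->.
  move=> x y /setU1P[->|xD] /setU1P[->|yD];
    [exact: rcompxx|by rewrite rcompC Dp|exact: Dp|exact: Dc].
- move=> x rxp xD; apply/setU1P.
  case/orP: (xD q (setU1r _ qD)) => [rxq|rqx].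
    by right; apply: Dm => // y yD; apply: xD; rewrite setU1r.
  by case: (qmax x rqx rxp) => ->; [right|left].
Qed.

(** Each product contains the value at [p] once and otherwise only values strictly below [p]; the
    ratio of [down_sum v p] to [v p] is compared by cross-multiplication. *)
Lemma down_sum_ratio v v' p : (forall y, r y p -> y != p -> v y = v' y) ->
  down_sum v p * v' p = down_sum v' p * v p.
Proof.
move=> vv'; rewrite /down_sum !mulr_suml; apply: eq_bigr => C.
case/down_chainP => pC Cp _ _; rewrite !(big_setD1 _ pC) /= mulrAC [RHS]mulrAC.
rewrite [v' p * v p]mulrC; congr (_ * _).
by apply: eq_bigr => y /setD1P[yp /Cp ryp]; exact: vv'.
Qed.

Lemma down_sum_ge0 v p : (forall x, 0 < v x) -> 0 <= down_sum v p.
Proof. by move=> v0; apply: sumr_ge0 => C _; apply: prodr_ge0 => y _; exact: ltW. Qed.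

End DownChains.

(** * Telescoping products in triangular arrays *)

Section Arrays.
Context (R : realType) (r : nat) (kappa : R).
(* The array p m holds the labels after m factors of LK, indexed by the ends of
   the intervals (or by their mirror images). *)
Variables p U D : nat -> nat -> nat -> R.

(** The ratio of [D] to [p]: a sum over the two lower covers of [a, b], and 1 for the minimal
    intervals [a, a]. *)
Let W m a b := if (a < b)%N then D m a b.-1 + D m a.+1 b else 1.

Hypothesis U_gt0 : forall m a b, 0 < U m a b.
Hypothesis kappa_gt0 : 0 < kappa.
(** Recursion over the upper covers; the last summand is the value 1 for the top interval [0, r],
    which has none. *)
Hypothesis UE : forall m a b, (a <= b <= r)%N ->
  U m a b = p m a b * ((if (0 < a)%N then U m a.-1 b else 0) +
    (if (b < r)%N then U m a b.+1 else 0) + ((a == 0) && (b == r))%N%:R).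
Hypothesis DE : forall m a b, (a <= b <= r)%N -> D m a b = p m a b * W m a b.
Hypothesis D_low : forall m a b, (a <= b <= r)%N -> (b - a < m)%N ->
  D m.+1 a b = D m a b.
Hypothesis D_mul_U : forall m a b, (a <= b <= r)%N -> (m <= b - a)%N ->
  D m.+1 a b * U m a b = kappa.

(* Since D (m+1) = kappa / U m in the ranks >= m, both sides are products of
   explicit ratios of values of U m, and they agree after telescoping. *)
Lemma W_prod m a i : (i = a + m.+1)%N -> (i <= r)%N ->
  W m.+1 a i * \prod_(i <= j < r.+1) p m.+1 a j =
  D m.+1 a.+1 i * \prod_(i <= j < r.+1) p m a.+1 j.
Proof.
move=> ia ir.
have DU b c : (b <= c <= r)%N -> (m <= c - b)%N -> D m.+1 b c = kappa / U m b c.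
  by move=> bc mbc; rewrite -(D_mul_U bc mbc) mulfK ?gt_eqF.
have U0 b c : U m b c != 0 by rewrite gt_eqF.
have UU0 b c b' c' : U m b c + U m b' c' != 0 by rewrite gt_eqF ?addr_gt0.
have k0 : kappa != 0 by rewrite gt_eqF.
(* This is [D / W] with [kappa] cancelled: as [i = a + m + 1], both lower covers still have rank at
   least [m], where [D] is [kappa / U]. *)
have p_new k : (i <= k <= r)%N ->
    p m.+1 a k = (U m a k)^-1 / ((U m a k.-1)^-1 + (U m a.+1 k)^-1).
  move=> ikr; have := @DE m.+1 a k; rewrite /W ifT; last by lia.
  move=> /(_ _)-/(_ ltac:(lia)); rewrite !DU; try lia.
  move=> e; apply: (@mulIf _ (kappa / U m a k.-1 + kappa / U m a.+1 k)).
    by rewrite gt_eqF // addr_gt0 // divr_gt0.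
  by rewrite -e; field; rewrite !U0 UU0.
(* The last two factors are the discrepancy between the partial products. At [k = i] it comes from
   the definition of [W], and the labels of index [k] carry it to [k + 1]. *)
have partial k : (i <= k <= r)%N ->
    W m.+1 a i * \prod_(i <= j < k) p m.+1 a j =
    D m.+1 a.+1 i * \prod_(i <= j < k) p m a.+1 j *
      ((U m a k.-1)^-1 + (U m a.+1 k)^-1) * U m a.+1 k.
  elim: k => [|k IH]; first by lia.
  move=> /andP[]; rewrite leq_eqVlt => /orP[/eqP ik _|ik kr].
    rewrite -ik !big_geq // !mulr1 /W ifT; last by lia.
    by rewrite !DU; try lia; field; rewrite !U0.
  rewrite !big_nat_recr //= !mulrA IH; last by lia.
  have p_old : p m a.+1 k = U m a.+1 k / (U m a k + U m a.+1 k.+1).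
    have := @UE m a.+1 k; rewrite [(k < r)%N]kr /= addr0.
    by move=> /(_ _)-/(_ ltac:(lia)) ->; rewrite mulfK.
  by rewrite p_new ?p_old; [field; rewrite !U0 !UU0|lia].
rewrite !big_nat_recr //= !mulrA partial; last by lia.
(* The interval [a + 1, r] has a single upper cover, so its label absorbs the discrepancy. *)
have p_old : p m a.+1 r = U m a.+1 r / U m a r.
  have := @UE m a.+1 r; rewrite ltnn /= !addr0.
  by move=> /(_ _)-/(_ ltac:(lia)) ->; rewrite mulfK.
by rewrite p_new ?p_old; [field; rewrite !U0 !UU0|lia].
Qed.

(** Induction on [a] with [m = i - a]. [W_prod] moves the row product from row [a] at stage [m + 1]
    to row [a + 1] at stage [m]; the factor [D] that it produces is the next new label of column [i]
    times its [W]. *)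
Lemma diag_prod a m i : (i = a + m)%N -> (i <= r)%N ->
  (\prod_(0 <= c < a.+1) p (i - c).+1 c i) * W m a i *
    (\prod_(i <= j < r.+1) p m a j) = kappa.
Proof.
(* The lower covers have rank below [m'], so their [D], and hence [W], is the same at stages [m']
   and [m' + 1]. *)
have DW m' a' i' : (a' <= i' <= r)%N -> (i' - a' = m')%N ->
    p m'.+1 a' i' * W m' a' i' = kappa / U m' a' i'.
  move=> h e; rewrite -(@D_mul_U m' a' i') //; last by lia.
  rewrite mulfK ?gt_eqF // DE // /W; congr (_ * _); case: ifP => // ai.
  by congr (_ + _); rewrite D_low //; lia.
elim: a m i => [|a IH] m i ia ir.
  have {ia} im : i = m by lia.
  subst i; rewrite big_nat1 subn0.
  rewrite DW; try lia.
  (* A single chain leads from [0, k] to the top, so [U] is a product of labels of row 0; the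
     induction starts from column [r]. *)
  suff UP j : (j <= r)%N -> \prod_(r - j <= k < r.+1) p m 0%N k = U m 0%N (r - j)%N.
    have -> : \prod_(m <= j < r.+1) p m 0%N j = U m 0%N m.
      by have := UP (r - m)%N (leq_subr _ _); rewrite subKn //; lia.
    by rewrite divfK ?gt_eqF.
  elim: j => [|j IHj] jr.
    by rewrite subn0 big_nat1 UE ?leqnn // !ltnn !eqxx /= !add0r mulr1.
  rewrite big_ltn; last by lia.
  have -> : (r - j.+1).+1 = (r - j)%N by lia.
  rewrite IHj; last by lia.
  rewrite [RHS]UE; last by lia.
  have -> : (r - j.+1 < r)%N by lia.
  have -> : ((r - j.+1)%N == r) = false by lia.
  have -> : (r - j.+1).+1 = (r - j)%N by lia.
  by rewrite /= add0r addr0.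
rewrite big_nat_recr //= -(IH m.+1 i); try lia.
rewrite -!mulrA W_prod; try lia.
congr (_ * _); rewrite !mulrA; congr (_ * _).
have -> : (i - a.+1)%N = m by lia.
rewrite DW; try lia.
by rewrite -(@D_mul_U m a.+1 i) ?mulfK ?gt_eqF //; lia.
Qed.

(** The case [a = i], [m = 0], where [W = 1]. The index [(i - c).+1] is the stage from which the
    label of [c, i], of rank [i - c], is final. *)
Lemma row_col_prod i : (i <= r)%N ->
  (\prod_(0 <= c < i.+1) p (i - c).+1 c i) * (\prod_(i <= j < r.+1) p 0 i j) = kappa.
Proof.
by move=> ir; rewrite -(@diag_prod i 0 i) ?addn0 // /W ltnn mulr1.
Qed.

End Arrays.

(** * Splitting the maximal chains at an element; injectivity of toggles *)

Section ChainSum.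
Context (R : realType) (d : Order.disp_t) (P : finPOrderType d).
Implicit Types (p x y : P) (C : {set P}) (pi : labeling R P).

Definition lep : rel P := fun x y => (x <= y)%O.
Definition gep : rel P := fun x y => (y <= x)%O.

Lemma lep_refl : reflexive lep. Proof. exact: lexx. Qed.

Lemma lep_anti : antisymmetric lep. Proof. exact: le_anti. Qed.

Lemma lep_trans : transitive lep. Proof. exact: le_trans. Qed.

Lemma gep_refl : reflexive gep. Proof. exact: lexx. Qed.

Lemma gep_anti : antisymmetric gep.
Proof. by move=> x y /andP[yx xy]; apply/le_anti/andP. Qed.

Lemma gep_trans : transitive gep.
Proof. by move=> y x z yx zy; exact: le_trans zy yx. Qed.

Definition Dn pi p : R := down_sum lep (fun y => (pi y)%:num) p.
Definition Up pi p : R := down_sum gep (fun y => (pi y)%:num) p.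

Lemma maxchainP C :
  reflect ({in C &, forall x y, (x >=< y)%O} /\
    forall x, {in C, forall y, (x >=< y)%O} -> x \in C)
    (maxchain C).
Proof.
have chP (E : {set P}) : reflect {in E &, forall x y, (x >=< y)%O} (chain E).
  apply: (iffP forall_inP) => h x.
    by move=> y /h /forall_inP; apply.
  by move=> xE; apply/forall_inP => y yE; exact: h.
apply: (iffP maxsetP) => [[/chP Cc Cm]|[Cc Cm]]; split; [by []| |exact/chP|].
  move=> x xC; rewrite -(Cm (x |: C)) ?finset.subsetUr ?setU11 //.
  apply/chP => y z /setU1P[->|yC] /setU1P[->|zC].
  - exact: comparablexx.
  - exact: xC.
  - by rewrite comparable_sym; exact: xC.
  - exact: Cc.
move=> B /chP Bc CB; apply/eqP; rewrite finset.eqEsubset CB andbT.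
apply/fintype.subsetP => x xB; apply: Cm => y yC; apply: Bc => //.
exact: (fintype.subsetP CB).
Qed.

(** A maximal chain through [p] is, uniquely, a maximal chain below [p] glued to one above [p]; as
    [p] lies in both halves, its label is needed twice. *)
Lemma chain_sumM p pi : chain_sum p pi * (pi p)%:num = Dn pi p * Up pi p.
Proof.
rewrite /Dn /Up /down_sum big_distrlr /= pair_big /=.
rewrite (reindex_onto (fun C => (C :&: [set x | lep x p], C :&: [set x | gep x p]))
  (fun DE => DE.1 :|: DE.2)) /=; last first.
  move=> [D E] /= /andP[/down_chainP[pD Dp _ _] /down_chainP[pE Ep _ _]].
  congr pair; apply/setP => x; rewrite !inE; apply/andP/idP.
  - case=> /orP[//|xE xp]; suff -> : x = p by [].
    by apply/le_anti/andP; split; [exact: xp|exact: Ep].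
  - by move=> xD; rewrite xD Dp.
  - case=> /orP[xD xp|//]; suff -> : x = p by [].
    by apply/le_anti/andP; split; [exact: Dp|exact: xp].
  - by move=> xE; rewrite xE orbT Ep.
rewrite /chain_sum mulr_suml; apply: eq_big => C.
  rewrite -finset.setIUr; apply/andP/andP.
    case=> /maxchainP[Cc Cm] pC; split; last first.
      apply/eqP/finset.setIidPl/fintype.subsetP => x xC.
      by rewrite !inE /lep /gep; exact: Cc.
    apply/andP; split; apply/down_chainP; split.
    - by rewrite !inE pC /lep lexx.
    - by move=> x; rewrite !inE => /andP[].
    - by move=> x y /setIP[xC _] /setIP[yC _]; exact: Cc.
    - move=> x xp xC; rewrite !inE xp andbT; apply: Cm => y yC.
      have /orP[yp|py] := Cc _ _ yC pC.
        by apply: xC; rewrite !inE yC.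
      by rewrite /Order.comparable (le_trans xp py).
    - by rewrite !inE pC /gep lexx.
    - by move=> x; rewrite !inE => /andP[].
    - by move=> x y /setIP[xC _] /setIP[yC _]; rewrite /rcomp orbC; exact: Cc.
    - move=> x xp xC; rewrite !inE xp andbT; apply: Cm => y yC.
      have /orP[yp|py] := Cc _ _ yC pC.
        by rewrite /Order.comparable (le_trans yp xp) orbT.
      by rewrite comparable_sym; apply: xC; rewrite !inE yC.
  case=> /andP[/down_chainP[pD _ Dc Dm] /down_chainP[_ _ Ec Em]] /eqP/finset.setIidPl.
  move=> /fintype.subsetP Cp; have pC : p \in C by case/setIP: pD.
  split=> //; apply/maxchainP; split.
    move=> x y xC yC; move: (Cp x xC) (Cp y yC); rewrite !inE.
    move=> /orP[xp|px] /orP[yp|py].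
    - by apply: Dc; rewrite !inE ?xC ?yC.
    - by rewrite /Order.comparable (le_trans xp py).
    - by rewrite /Order.comparable (le_trans yp px) orbT.
    - by rewrite comparable_sym; apply: Ec; rewrite !inE ?xC ?yC.
  move=> x xC; have /orP[xp|px] := xC _ pC.
    suff /setIP[] : x \in C :&: [set y | lep y p] by [].
    by apply: Dm => // y /setIP[/xC].
  suff /setIP[] : x \in C :&: [set y | gep y p] by [].
  by apply: Em => // y /setIP[/xC]; rewrite comparable_sym.
move=> /andP[/maxchainP[Cc Cm] pC].
(* The lower half takes the [p] of the chain, and the extra factor completes the upper half. *)
rewrite (big_setID [set x | lep x p]) /= -mulrA; congr (_ * _).
rewrite [RHS](bigD1 p) ?inE ?pC /gep ?lexx //= mulrC; congr (_ * _).
apply: eq_bigl => x; rewrite !inE /lep.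
have [xC|] := boolP (x \in C); last by rewrite andbF.
rewrite andbT /=; have [->|xp] := eqVneq x p; first by rewrite lexx andbF.
rewrite andbT; have /orP[h|h] := Cc _ _ xC pC; rewrite h /=.
  by apply/esym/negbTE; apply: contra xp => h'; rewrite eq_le h.
by rewrite (contra _ xp) // => h'; rewrite eq_le h h'.
Qed.

Lemma Dn_mul_Up_gt0 pi p : 0 < Dn pi p * Up pi p.
Proof. by rewrite -chain_sumM mulr_gt0 // chain_sum_gt0. Qed.

Lemma Dn_gt0 pi p : 0 < Dn pi p.
Proof.
rewrite lt_neqAle down_sum_ge0 // andbT; apply/eqP => e.
by have := Dn_mul_Up_gt0 pi p; rewrite -e mul0r ltxx.
Qed.

Lemma Up_gt0 pi p : 0 < Up pi p.
Proof. by have := Dn_mul_Up_gt0 pi p; rewrite pmulr_rgt0 ?Dn_gt0. Qed.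

Lemma eq_Dn pi pi' p : (forall y, (y <= p)%O -> pi y = pi' y) -> Dn pi p = Dn pi' p.
Proof. by move=> e; apply: eq_down_sum => y /e ->. Qed.

Lemma eq_Up pi pi' p : (forall y, (p <= y)%O -> pi y = pi' y) -> Up pi p = Up pi' p.
Proof. by move=> e; apply: eq_down_sum => y /e ->. Qed.

Lemma Dn_ratio pi pi' p : (forall y, (y < p)%O -> pi y = pi' y) ->
  Dn pi p * (pi' p)%:num = Dn pi' p * (pi p)%:num.
Proof.
by move=> e; apply: down_sum_ratio => y yp ynp; rewrite e // lt_neqAle ynp.
Qed.

Lemma eq_chain_sum pi pi' p : (forall y, (y >=< p)%O -> pi y = pi' y) ->
  chain_sum p pi = chain_sum p pi'.
Proof.
move=> e; apply: eq_bigr => C /andP[/maxchainP[Cc _] pC].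
by apply: eq_bigr => y yC; rewrite e //; exact: Cc.
Qed.

(** [chain_sum p] is the label at [p] times a positive sum of products of other labels, which the
    toggle preserves; so the old label at [p] can be recovered. *)
Lemma toggle_inj kappa p : injective (@toggle R d P kappa p).
Proof.
move=> pi pi' e.
have ne x : x != p -> pi x = pi' x.
  by move=> xp; have /ffunP/(_ x) := e; rewrite !ffunE (negbTE xp).
have cs pi0 : chain_sum p pi0 = (pi0 p)%:num *
    \sum_(C : {set P} | maxchain C && (p \in C)) \prod_(y in C :\ p) (pi0 y)%:num.
  rewrite mulr_sumr; apply: eq_bigr => C /andP[_ pC]; exact: big_setD1.
apply/ffunP => x; have [->|/ne//] := eqVneq x p.
have /ffunP/(_ p) := e; rewrite !ffunE eqxx => /(congr1 (fun u => u%:num)) /=.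
have k0 : kappa%:num != 0 by rewrite gt_eqF.
move=> /(mulfI k0)/invr_inj; rewrite !cs => h.
apply: val_inj => /=; move: h (chain_sum_gt0 p pi).
rewrite cs (eq_bigr (fun C => \prod_(y in C :\ p) (pi' y)%:num)); last first.
  by move=> C _; apply: eq_bigr => y /setD1P[/ne ->].
move=> h h0; apply: (mulIf _ h); rewrite gt_eqF //.
by move: h0; rewrite pmulr_rgt0.
Qed.

End ChainSum.

(* The composite F (m + t - 1) \o ... \o F (m + 1) \o F m. *)
Fixpoint iter_from (T : Type) (F : nat -> T -> T) (m t : nat) (x : T) : T :=
  if t is t'.+1 then F (m + t')%N (iter_from F m t' x) else x.

Lemma big_comp_iter_from (T : Type) (F : nat -> T -> T) k m t (x : T) :
  (k.+1 = m + t)%N ->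
  (\big[(fun f g => f \o g)/id]_(l < t) F (k - l)%N) x = iter_from F m t x.
Proof.
elim: t k x => [|t IH] k x kmt; first by rewrite big_ord0.
rewrite big_ord_recl /= subn0 (_ : (m + t)%N = k); last by lia.
(* When no factor remains, [k] may be 0 and the induction hypothesis at [k.-1] would not apply. *)
congr (F _ _); case: t IH kmt => [|t] IH kmt; first by rewrite big_ord0.
by rewrite -(IH k.-1) //; [congr (_ x); apply: eq_bigr => l _; congr F; rewrite /= /bump; lia|lia].
Qed.

(** * Rowvacuation as a succession of passes through the ranks *)

Section Rowvacuation.
Context (R : realType) (d : Order.disp_t) (P : finPOrderType d).
Context (rk : P -> nat) (r : nat) (kappa : {posnum R}).
Hypothesis rk_lt : forall x y : P, (x < y)%O -> (rk x < rk y)%N.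
Hypothesis rk_le : forall x : P, (rk x <= r)%N.
Implicit Types (p x y : P) (pi : labeling R P).

(** Distinct elements of equal rank are incomparable, and the chain sum at [x] involves only
    elements comparable to [x]; so the toggles of one rank act simultaneously on the old labels. *)
Lemma rank_toggleE k pi x :
  (rank_toggle rk kappa k pi x)%:num =
    if rk x == k then kappa%:num / chain_sum x pi else (pi x)%:num.
Proof.
rewrite /rank_toggle -big_filter.
have : uniq [seq p <- index_enum P | rk p == k] by rewrite filter_uniq // index_enum_uniq.
have : {subset [seq p <- index_enum P | rk p == k] <= [pred p | rk p == k]}.
  by move=> p; rewrite mem_filter => /andP[].
have -> : (rk x == k) = (x \in [seq p <- index_enum P | rk p == k]).
  by rewrite mem_filter mem_index_enum andbT.
elim: [seq p <- _ | _] x => [|q s IH] x sk; first by rewrite big_nil.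
move=> /= /andP[qs us]; rewrite big_cons /= !ffunE in_cons.
have sk' : {subset s <= [pred p | rk p == k]} by move=> y ys; apply: sk; rewrite in_cons ys orbT.
have [->|xq] := eqVneq x q; last by rewrite IH.
rewrite /=; congr (_ / _); apply: eq_chain_sum => y yq.
apply: val_inj; rewrite /= IH //; case: ifP => // ys.
have /eqP rq : rk q == k by apply: sk; rewrite in_cons eqxx.
have /eqP ry : rk y == k by apply: sk'.
have [e|yq'] := eqVneq y q; first by rewrite -e ys in qs.
by case/orP: yq => h; [have := @rk_lt y q|have := @rk_lt q y];
  rewrite lt_neqAle h ?yq' 1?eq_sym ?yq' ry rq ltnn => /(_ isT).
Qed.

(* The composite tau_r ... tau_(m+1) tau_m. *)
Definition pass m pi := iter_from (rank_toggle rk kappa) m (r.+1 - m) pi.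

(** The factor of index [j] starts at rank [r - j], so the passes are applied in the order 0, 1,
    ..., [r]. *)
Lemma rvacE pi : rvac r rk kappa pi = iter_from pass 0 r.+1 pi.
Proof.
rewrite -(@big_comp_iter_from _ _ r) // /rvac; congr (_ pi).
apply: eq_bigr => j _; apply: funext => pi'.
have jr := ltn_ord j.
rewrite (@big_comp_iter_from _ _ r (r - j)); last by lia.
by rewrite /pass (_ : (r.+1 - (r - j))%N = j.+1) //; lia.
Qed.

Lemma iter_rank_toggle_id m t pi x : ~~ (m <= rk x < m + t)%N ->
  iter_from (rank_toggle rk kappa) m t pi x = pi x.
Proof.
elim: t => //= t IH h; apply: val_inj; rewrite /= rank_toggleE ifF; last by lia.
by rewrite IH //; lia.
Qed.

Lemma iter_rank_toggle_stable m t pi x : (m <= rk x <= r)%N -> (rk x < m + t)%N ->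
  iter_from (rank_toggle rk kappa) m t pi x =
  iter_from (rank_toggle rk kappa) m (rk x - m).+1 pi x.
Proof.
elim: t => [|t IH] h1 h2; first by lia.
have [e|ne] := eqVneq (rk x) (m + t)%N; first by rewrite e addKn.
rewrite -IH //; last by lia.
by apply: val_inj; rewrite [LHS]rank_toggleE ifF //; exact/negbTE.
Qed.

Lemma pass_low m pi x : (rk x < m)%N -> pass m pi x = pi x.
Proof. by move=> h; apply: iter_rank_toggle_id; lia. Qed.

Lemma pass_Dn_low m pi x : (rk x < m)%N -> Dn (pass m pi) x = Dn pi x.
Proof.
move=> h; apply: eq_Dn => y; rewrite le_eqVlt => /orP[/eqP->|/rk_lt yx].
  exact: pass_low.
by apply: pass_low; lia.
Qed.

(** In [s], just before the rank of [x] is toggled, the labels at and above [x] are old and those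
    strictly below are already final for the pass. The new label is
    [kappa * s x / (Dn s x * Up s x)], and [Dn] scales with the label at [x]. *)
Lemma pass_high m pi x : (m <= rk x)%N -> Dn (pass m pi) x * Up pi x = kappa%:num.
Proof.
move=> mx; have xr := rk_le x.
set s := iter_from (rank_toggle rk kappa) m (rk x - m) pi.
have sup y : (x <= y)%O -> s y = pi y.
  rewrite le_eqVlt => /orP[/eqP<-|/rk_lt yx]; apply: iter_rank_toggle_id; lia.
have sdn y : (y < x)%O -> pass m pi y = s y.
  move=> yx; have {}yx := rk_lt yx; have [my|ym] := leqP m (rk y).
    by rewrite /pass /s [LHS]iter_rank_toggle_stable ?[RHS]iter_rank_toggle_stable //; lia.
  by rewrite pass_low // /s iter_rank_toggle_id //; lia.
have px : (pass m pi x)%:num = kappa%:num / chain_sum x s.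
  rewrite /pass iter_rank_toggle_stable; try lia.
  by rewrite /= rank_toggleE subnKC // eqxx.
have := Dn_ratio sdn; rewrite px -(eq_Up sup) => e.
apply: (mulIf (lt0r_neq0 (gt0 (s x)))).
rewrite mulrAC e mulrAC -chain_sumM.
by field; rewrite gt_eqF // chain_sum_gt0.
Qed.

(** The passes numbered [rk x + 1] and beyond toggle only ranks above that of [x]. *)
Lemma rvac_pass pi x t : (rk x < t)%N -> (t <= r.+1)%N ->
  iter_from pass 0 t pi x = iter_from pass 0 (rk x).+1 pi x.
Proof.
elim: t => // t IH xt tr.
have [->//|ne] := eqVneq (rk x) t.
by rewrite -IH /=; [apply: pass_low; lia|lia|lia].
Qed.

Lemma rvac_inj : injective (@rvac R d P r rk kappa).
Proof.
rewrite /rvac; apply: big_ind => [//|f g|j _]; first exact: inj_comp.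
apply: big_ind => [//|f g|l _]; first exact: inj_comp.
by apply: big_ind => [//|f g|p _]; [exact: inj_comp|exact: toggle_inj].
Qed.

End Rowvacuation.

(** * Finite orbits and mesy from a pointwise identity *)

Lemma finite_orbit_perm (T : choiceType) (f : T -> T) (O : set T) :
  injective f -> is_orbit f O -> finite_set O ->
  perm_eq (map f (fset_set O)) (fset_set O).
Proof.
move=> fI [x Oe] fO.
have Of y : y \in fset_set O -> f y \in fset_set O.
  rewrite !in_fset_set // !inE Oe /= => -[m [e|e]].
    by exists m.+1; left; rewrite iterS e.
  (* Either [y] is the base point, one step before [f y], or [f y] reaches the base point one step
     sooner than [y]. *)
  case: m e => [|m] e; first by exists 1%N; left; rewrite /= -e.
  by exists m; right; rewrite -iterSr.
have fu : uniq (map f (fset_set O)) by rewrite map_inj_uniq // fset_uniq.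
have [||_ eqi] := uniq_min_size fu (s2 := fset_set O).
- by move=> _ /mapP[y yO ->]; exact: Of.
- by rewrite size_map.
- exact: uniq_perm fu (fset_uniq _) eqi.
Qed.

(** As [f] permutes the orbit, the square of the product of [h] is the product of the
    [h x * h (f x)]; positivity then allows taking roots. *)
Lemma mult_mesic_mul (R : realType) (T : choiceType) (f : T -> T) (h : T -> R) c :
  injective f -> (forall x, 0 < h x) -> 0 < c -> (forall x, h x * h (f x) = c ^+ 2) ->
  mult_mesic f h c.
Proof.
move=> fI h0 c0 hf O orbO fO.
have fperm := finite_orbit_perm fI orbO fO.
have prod_gt0 : 0 < \prod_(x <- fset_set O) h x by exact: prodr_gt0.
have N0 : (0 < #|` fset_set O|)%N.
  rewrite cardfs_gt0; apply/fset0Pn; case: (orbO) => x Oe; exists x.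
  by rewrite in_fset_set // inE Oe; exists 0%N; left.
have -> : \prod_(x <- fset_set O) h x = c ^+ #|` fset_set O|.
  apply/eqP; rewrite -(@eqrXn2 _ 2) ?exprn_ge0 ?ltW //.
  rewrite -exprM mulnC exprM expr2.
  rewrite -{2}(perm_big _ fperm) big_map -big_split /=.
  by rewrite (eq_bigr _ (fun x _ => hf x)) big_const_seq count_predT iter_mulr_1.
rewrite -powR_mulrn ?ltW // -powRrM divff ?powRr1 ?ltW //.
by rewrite pnatr_eq0 -lt0n.
Qed.

Lemma big_pred2_if (V : nmodType) (T : finType) (c1 c2 : bool) (q1 q2 : T) (F : T -> V) :
  q1 != q2 ->
  \sum_(q | (c1 && (q == q1)) || (c2 && (q == q2))) F q =
  (if c1 then F q1 else 0) + (if c2 then F q2 else 0).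
Proof.
move=> ne; case: c1 c2 => [] [] /=.
- rewrite (bigD1 q1) ?eqxx //=; congr (_ + _); apply: big_pred1 => q /=.
  by have [->|] := eqVneq q q1; rewrite /= ?andbT ?(negbTE ne).
- by rewrite addr0; apply: big_pred1 => q; rewrite orbF.
- by rewrite add0r; apply: big_pred1.
- by rewrite addr0; apply: big_pred0.
Qed.

Lemma prod_nat_rev (R : comNzRingType) r (F : nat -> R) i : (i <= r)%N ->
  \prod_(0 <= c < (r - i).+1) F (r - c)%N = \prod_(i <= j < r.+1) F j.
Proof.
move=> ir; rewrite [RHS](big_addn 0 _ i) subSn // big_nat_rev /=.
by apply: eq_big_nat => j jr; congr F; lia.
Qed.

(** * Covers and chain sums in the poset of intervals *)

Section Segments.
Context (R : realType) (r : nat).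
Implicit Types (x y : segment r.+1) (pi : labeling R (segment r.+1)).

Definition lo x : nat := (ends x).1.
Definition hi x : nat := (ends x).2.
(** Indexing by naturals matches the arrays; outside [a <= b <= r] the value is a mere default. *)
Definition sg (a b : nat) : segment r.+1 := seg (inord a) (inord b).

Lemma lo_hi x : (lo x <= hi x)%N. Proof. exact: ends_le. Qed.

Lemma hi_le x : (hi x <= r)%N. Proof. by rewrite -ltnS; exact: ltn_ord. Qed.

Lemma segment_leE x y : (x <= y)%O = (lo y <= lo x)%N && (hi x <= hi y)%N.
Proof.
have := lo_hi x; rewrite /lo /hi => lhx.
apply/fintype.subsetP/andP => [sub|[h1 h2] k]; last first.
  by rewrite !inE => /andP[k1 k2]; rewrite (leq_trans h1 k1) (leq_trans k2 h2).
have := sub (ends x).1; have := sub (ends x).2.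
by rewrite !inE !leqnn lhx /= => /(_ isT)/andP[_ ->] /(_ isT)/andP[-> _].
Qed.

Lemma segment_eqP x y : lo x = lo y -> hi x = hi y -> x = y.
Proof. by move=> l h; apply/le_anti; rewrite !segment_leE l h !leqnn. Qed.

Lemma lo_sg a b : (a <= b <= r)%N -> lo (sg a b) = a.
Proof.
move=> abr; rewrite /lo /sg /seg insubdK ?inordK //; first by lia.
by rewrite unfold_in /= !inordK; lia.
Qed.

Lemma hi_sg a b : (a <= b <= r)%N -> hi (sg a b) = b.
Proof.
move=> abr; rewrite /hi /sg /seg insubdK ?inordK //; first by lia.
by rewrite unfold_in /= !inordK; lia.
Qed.

Lemma eq_sgE x c e : (c <= e <= r)%N ->
  (x == sg c e) = (lo x == c) && (hi x == e).
Proof.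
move=> ce; apply/eqP/andP => [->|[/eqP l /eqP h]]; first by rewrite lo_sg ?hi_sg.
by apply: segment_eqP; rewrite ?lo_sg ?hi_sg.
Qed.

Lemma segment_rank_sg a b : (a <= b <= r)%N -> segment_rank (sg a b) = (b - a)%N.
Proof. by move=> abr; rewrite /segment_rank -/(lo _) -/(hi _) lo_sg ?hi_sg. Qed.

Lemma segment_rank_lt x y : (x < y)%O -> (segment_rank x < segment_rank y)%N.
Proof.
rewrite lt_neqAle segment_leE => /andP[/eqP ne /andP[h1 h2]].
rewrite /segment_rank -!/(lo _) -!/(hi _); have := lo_hi x.
suff : ~ (lo x = lo y /\ hi x = hi y) by lia.
by case=> e1 e2; apply: ne; exact: segment_eqP.
Qed.

Lemma segment_rank_le x : (segment_rank x <= r)%N.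
Proof. by rewrite /segment_rank -!/(lo _) -!/(hi _); have := hi_le x; lia. Qed.

(** An interval strictly inside [a, b] misses one of its ends, so it lies in [a, b - 1] or
    [a + 1, b]. *)
Lemma covered_down a b x : (a < b <= r)%N ->
  covered (@lep _ _) x (sg a b) = (x == sg a b.-1) || (x == sg a.+1 b).
Proof.
move=> abr; have lx := lo_hi x.
rewrite !eq_sgE; try lia.
apply/coveredP/idP.
  rewrite /lep => -[]; rewrite eq_sgE; last by lia.
  rewrite segment_leE lo_sg ?hi_sg; try lia.
  move=> ne le_x xm.
  have [al|la] := ltnP a (lo x).
    have := xm (sg a.+1 b); rewrite !segment_leE !lo_sg ?hi_sg; try lia.
    move=> /(_ ltac:(lia) ltac:(lia))[e|/(congr1 lo)].
      by rewrite -e lo_sg ?hi_sg; lia.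
    by rewrite !lo_sg; lia.
  have := xm (sg a b.-1); rewrite !segment_leE !lo_sg ?hi_sg; try lia.
  move=> /(_ ltac:(lia) ltac:(lia))[e|/(congr1 hi)].
    by rewrite -e lo_sg ?hi_sg; lia.
  by rewrite !hi_sg; lia.
move=> xE; rewrite /lep eq_sgE ?segment_leE ?lo_sg ?hi_sg; try lia.
split; try lia.
move=> y; rewrite !segment_leE lo_sg ?hi_sg; try lia.
move=> h1 h2; have := lo_hi y => ly.
have [[e1 e2]|[e1 e2]] : lo y = lo x /\ hi y = hi x \/ lo y = a /\ hi y = b by lia.
  by left; exact: segment_eqP.
by right; apply: segment_eqP; rewrite ?lo_sg ?hi_sg //; lia.
Qed.

(** The guards discard the covers that would leave [0, r]. *)
Lemma covered_up a b x : (a <= b <= r)%N ->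
  covered (@gep _ _) x (sg a b) =
    ((0 < a)%N && (x == sg a.-1 b)) || ((b < r)%N && (x == sg a b.+1)).
Proof.
move=> abr; have lx := lo_hi x; have hx := hi_le x.
have -> : (b < r)%N && (x == sg a b.+1) = (b < r)%N && ((lo x == a) && (hi x == b.+1)).
  by case: ltnP => //= br; rewrite eq_sgE //; lia.
rewrite (@eq_sgE x a.-1 b); last by lia.
apply/coveredP/idP.
  rewrite /gep => -[]; rewrite eq_sgE; last by lia.
  rewrite segment_leE lo_sg ?hi_sg; try lia.
  move=> ne le_x xm.
  have [la|al] := ltnP (lo x) a.
    have := xm (sg a.-1 b); rewrite !segment_leE !lo_sg ?hi_sg; try lia.
    move=> /(_ ltac:(lia) ltac:(lia))[e|/(congr1 lo)].
      by rewrite -e lo_sg ?hi_sg; lia.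
    by rewrite !lo_sg; lia.
  have := xm (sg a b.+1); rewrite !segment_leE !lo_sg ?hi_sg; try lia.
  move=> /(_ ltac:(lia) ltac:(lia))[e|/(congr1 hi)].
    by rewrite -e lo_sg ?hi_sg; lia.
  by rewrite !hi_sg; lia.
move=> xE; rewrite /gep eq_sgE ?segment_leE ?lo_sg ?hi_sg; try lia.
split; try lia.
move=> y; rewrite !segment_leE lo_sg ?hi_sg; try lia.
move=> h1 h2; have := lo_hi y => ly.
have [[e1 e2]|[e1 e2]] : lo y = lo x /\ hi y = hi x \/ lo y = a /\ hi y = b by lia.
  by left; exact: segment_eqP.
by right; apply: segment_eqP; rewrite ?lo_sg ?hi_sg //; lia.
Qed.

Lemma Dn_sg pi a b : (a <= b <= r)%N ->
  Dn pi (sg a b) = (pi (sg a b))%:num *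
    (if (a < b)%N then Dn pi (sg a b.-1) + Dn pi (sg a.+1 b) else 1).
Proof.
move=> abr; have [ab|ba] := ltnP a b.
  rewrite [LHS](down_sum_covered (@lep_refl _ _) (@lep_anti _ _) (@lep_trans _ _)); last first.
    exists (sg a.+1 b); last by rewrite /lep segment_leE !lo_sg ?hi_sg; lia.
    by apply/eqP => /(congr1 lo); rewrite !lo_sg; lia.
  congr (_ * _).
  rewrite (eq_bigl (fun x => (true && (x == sg a b.-1)) || (true && (x == sg a.+1 b)))).
    by rewrite big_pred2_if //; apply/eqP => /(congr1 lo); rewrite !lo_sg; lia.
  by move=> x; rewrite covered_down //; lia.
rewrite mulr1; apply: (down_sum_min (@lep_refl _ _)) => x; rewrite /lep segment_leE lo_sg ?hi_sg //.
by have := lo_hi x => ? ?; apply: segment_eqP; rewrite ?lo_sg ?hi_sg //; lia.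
Qed.

Lemma Up_sg pi a b : (a <= b <= r)%N ->
  Up pi (sg a b) = (pi (sg a b))%:num *
    ((if (0 < a)%N then Up pi (sg a.-1 b) else 0) +
     (if (b < r)%N then Up pi (sg a b.+1) else 0) + ((a == 0) && (b == r))%N%:R).
Proof.
move=> abr; have [ab|ab] := boolP ((a == 0) && (b == r))%N.
  rewrite (_ : (0 < a)%N = false) 1?(_ : (b < r)%N = false); try lia.
  rewrite !add0r mulr1; apply: (down_sum_min (@gep_refl _ _)) => x.
  rewrite /gep segment_leE lo_sg ?hi_sg // => h.
  by have hx := hi_le x; apply: segment_eqP; rewrite ?lo_sg ?hi_sg //; lia.
rewrite addr0 [LHS](down_sum_covered (@gep_refl _ _) (@gep_anti _ _) (@gep_trans _ _)); last first.
  have [a0|a0] := posnP a.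
    exists (sg a b.+1); last by rewrite /gep segment_leE !lo_sg ?hi_sg; lia.
    by apply/eqP => /(congr1 hi); rewrite !hi_sg; lia.
  exists (sg a.-1 b); last by rewrite /gep segment_leE !lo_sg ?hi_sg; lia.
  by apply/eqP => /(congr1 lo); rewrite !lo_sg; lia.
congr (_ * _); under eq_bigl => x do rewrite covered_up //.
have [br|br] := ltnP b r.
  have [a0|a0] := posnP a.
    by rewrite add0r /=; apply: big_pred1.
  by rewrite big_pred2_if //; apply/eqP => /(congr1 hi); rewrite !hi_sg; lia.
have [a0|a0] := posnP a; first by lia.
by rewrite addr0 /=; apply: big_pred1 => x /=; rewrite orbF.
Qed.

(** * Products of labels before and after [LK] *)

Section LK.
Context (kappa : {posnum R}) (pi : labeling R (segment r.+1)).

Let st m := iter_from (pass (@segment_rank r.+1) r kappa) 0 m pi.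

Let LK_st a b : (a <= b <= r)%N -> LK kappa pi (sg a b) = st (b - a).+1 (sg a b).
Proof.
move=> abr; rewrite /LK rvacE rvac_pass ?segment_rank_sg //; try lia.
exact: segment_rank_lt.
Qed.

Let st_low m a b : (a <= b <= r)%N -> (b - a < m)%N ->
  Dn (st m.+1) (sg a b) = Dn (st m) (sg a b).
Proof.
move=> abr bam; rewrite /st /= (pass_Dn_low _ _ (@segment_rank_lt)) //.
by rewrite segment_rank_sg.
Qed.

Let st_high m a b : (a <= b <= r)%N -> (m <= b - a)%N ->
  Dn (st m.+1) (sg a b) * Up (st m) (sg a b) = kappa%:num.
Proof.
move=> abr bam; rewrite /st /= (pass_high _ (@segment_rank_lt) segment_rank_le) //.
by rewrite segment_rank_sg.
Qed.

Lemma LK_col_row i : (i <= r)%N ->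
  (\prod_(0 <= c < i.+1) (LK kappa pi (sg c i))%:num) *
  (\prod_(i <= j < r.+1) (pi (sg i j))%:num) = kappa%:num.
Proof.
move=> ir; rewrite -[RHS](@row_col_prod R r kappa%:num
  (fun m a b => (st m (sg a b))%:num) (fun m a b => Up (st m) (sg a b))
  (fun m a b => Dn (st m) (sg a b)) _ _ _ _ st_low st_high i ir).
- by congr (_ * _); apply: eq_big_nat => c ci; rewrite LK_st //; lia.
- by move=> m a b; exact: Up_gt0.
- exact: gt0.
- by move=> m a b abr; exact: Up_sg.
- by move=> m a b abr; exact: Dn_sg.
Qed.

(** [row_col_prod] for the reflected arrays, with [r - b, r - a] in place of [a, b] and [r - i] in
    place of [i]. The reflection preserves order and rank and exchanges the two covers on each side,
    so the recursions persist. *)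
Lemma LK_row_col i : (i <= r)%N ->
  (\prod_(i <= j < r.+1) (LK kappa pi (sg i j))%:num) *
  (\prod_(0 <= c < i.+1) (pi (sg c i))%:num) = kappa%:num.
Proof.
move=> ir; rewrite -[RHS](@row_col_prod R r kappa%:num
  (fun m a b => (st m (sg (r - b) (r - a)))%:num)
  (fun m a b => Up (st m) (sg (r - b) (r - a)))
  (fun m a b => Dn (st m) (sg (r - b) (r - a))) _ _ _ _ _ _ (r - i)%N (leq_subr _ _)).
- congr (_ * _).
    rewrite -(prod_nat_rev (fun j => (LK kappa pi (sg i j))%:num) ir).
    apply: eq_big_nat => c ci; rewrite LK_st; last by lia.
    by rewrite (subKn ir); congr ((st _.+1 _)%:num); lia.
  have := prod_nat_rev (fun j => (pi (sg (r - j) i))%:num) (leq_subr i r).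
  rewrite (subKn ir) => <-.
  by apply: eq_big_nat => c ci; rewrite subKn //; lia.
- by move=> m a b; exact: Up_gt0.
- exact: gt0.
- move=> m a b abr; rewrite Up_sg; last by lia.
  have -> : (r - a < r)%N = (0 < a)%N by lia.
  have -> : (0 < r - b)%N = (b < r)%N by lia.
  have -> : ((r - b == 0) && (r - a == r))%N = ((a == 0) && (b == r))%N by lia.
  have -> : (r - b).-1 = (r - b.+1)%N by lia.
  rewrite (addrC (if (b < r)%N then _ else _)).
  (* The equation for [r - a.-1] fails at [a = 0], where the guard makes the term 0. *)
  have [->|a0] := posnP a; first by [].
  by have -> : (r - a).+1 = (r - a.-1)%N by lia.
- move=> m a b abr; rewrite Dn_sg; last by lia.
  have -> : (r - b < r - a)%N = (a < b)%N by lia.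
  have -> : (r - a).-1 = (r - a.+1)%N by lia.
  rewrite (addrC (Dn _ _)); case: ltnP => [ab|_]; last by [].
  by have -> : (r - b).+1 = (r - b.-1)%N by lia.
- by move=> m a b abr bam; apply: st_low; lia.
- by move=> m a b abr bam; apply: st_high; lia.
Qed.

Lemma hstat_nat (i : 'I_r.+1) (rho : labeling R (segment r.+1)) :
  hstat i rho = (\prod_(i <= j < r.+1) (rho (sg i j))%:num) *
    (\prod_(0 <= j < i.+1) (rho (sg j i))%:num).
Proof.
rewrite /hstat; congr (_ * _).
  rewrite (big_nat_widenl i 0) // big_mkord.
  by apply: eq_bigr => j _; rewrite /sg !inord_val.
rewrite (big_nat_widen 0 i.+1 r.+1) // big_mkord.
by apply: eq_bigr => j _; rewrite /sg !inord_val.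
Qed.

Lemma hstat_LK (i : 'I_r.+1) :
  hstat i pi * hstat i (LK kappa pi) = kappa%:num ^+ 2.
Proof.
have ir : (i <= r)%N by rewrite -ltnS.
rewrite expr2 -{1}(LK_row_col ir) -(LK_col_row ir) !hstat_nat; ring.
Qed.

End LK.
End Segments.

Theorem theorem4p1 (R : realType) (n : nat) (hn : (1 <= n)%N)
    (kappa : {posnum R}) (i : 'I_n) :
  mult_mesic (@LK R n kappa) (@hstat R n i) kappa%:num.
Proof.
case: n hn i => // r _ i.
apply: mult_mesic_mul => //; last by move=> pi; exact: hstat_LK.
  exact: rvac_inj.
by move=> pi; apply: mulr_gt0; exact: prodr_gt0.
Qed.
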